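(* Let $\Bbbk$ be an algebraically closed field of arbitrary characteristic, let $M$ be a free abelian group of rank $n$, and let $A\subset M$ be a finite subset with $\operatorname{Aff}(A)=M$. Set $$B:=\{u_{i_0}+\cdots+u_{i_n}\in M\mid u_{i_0},\ldots,u_{i_n}\in A\text{ span the }\Bbbk\text{-affine space }M_{\Bbbk}\},$$ and let $\pi: M\to M':=M/(\langle B-B\rangle_{\mathbb{R}}\cap M)$ be the natural projection. Let $\tilde\pi: M\to\tilde M'$ be a surjective homomorphism of free abelian groups. Then $\tilde\pi$ factors through $\pi: M\to M'$, i.e. $\langle B-B\rangle\subset\ker\tilde\pi$, if and only if $$\sum_{j=0}^{\tilde N'}\dim\operatorname{Aff}_{\Bbbk}(A_j)=n-\tilde N',$$ where $\tilde N':=\#\tilde\pi(A)-1$, $\tilde\pi(A)=\{\tilde u'_0,\ldots,\tilde u'_{\tilde N'}\}$, and $A_j=\tilde\pi^{-1}(\tilde u'_j)\cap A$.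
   Context: $M_{\Bbbk}=M\otimes_{\mathbb{Z}}\Bbbk$. For a finite subset $S\subset M$: $\operatorname{Aff}(S)\subset M$ is the affine sublattice of all $\sum_i a_iu_i$ with $u_i\in S$, $a_i\in\mathbb{Z}$, $\sum_i a_i=1$; $\operatorname{Aff}_{\Bbbk}(S)\subset M_{\Bbbk}$ is the $\Bbbk$-affine subspace of all $\sum_i a_iu_i$ (taken in $M_{\Bbbk}$) with $u_i\in S$, $a_i\in\Bbbk$, $\sum_i a_i=1$, and $S$ spans the $\Bbbk$-affine space $M_{\Bbbk}$ if $\operatorname{Aff}_{\Bbbk}(S)=M_{\Bbbk}$. $\langle S-S\rangle\subset M$ is the subgroup generated by $S-S=\{u-u'\mid u,u'\in S\}$, and $\langle S-S\rangle_{\mathbb{R}}\subset M\otimes\mathbb{R}$ is the real subspace spanned by it. *)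

(* Defs.v *)
From HB Require Import structures.
From mathcomp Require Import all_boot all_order all_algebra finmap.
From mathcomp Require Import boolp classical_sets reals.

Set Implicit Arguments.
Unset Strict Implicit.
Unset Printing Implicit Defensive.

Import GRing.Theory.

Local Open Scope ring_scope.
Local Open Scope classical_set_scope.

Definition is_basis (M : zmodType) (n : nat) (b : 'I_n -> M) : Prop :=
  forall u : M, exists! c : {ffun 'I_n -> int}, u = \sum_(i < n) b i *~ c i.

Definition free_abelian (M : zmodType) (n : nat) : Prop :=
  exists b : 'I_n -> M, is_basis b.

(* The universal property of the map u |-> u (x) 1 from M to M (x)_Z F, which
   determines the F-vector space V together with iota up to a unique
   isomorphism.  A model is given by is_scalar_extension_coord below. *)
Definition is_scalar_extension (F : fieldType) (M : zmodType) (V : lmodType F)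
    (iota : {additive M -> V}) : Prop :=
  forall (W : lmodType F) (f : {additive M -> W}),
    (exists g : {linear V -> W}, forall u, g (iota u) = f u) /\
    (forall g1 g2 : {linear V -> W},
        (forall u, g1 (iota u) = f u) -> (forall u, g2 (iota u) = f u) ->
        forall v, g1 v = g2 v).

Lemma is_scalar_extension_coord (F : fieldType) (M : zmodType) (n : nat)
    (b : 'I_n -> M) : is_basis b ->
  exists iota : {additive M -> 'rV[F]_n},
    (forall i, iota (b i) = delta_mx 0 i) /\ is_scalar_extension iota.
Proof.
move=> hb.
pose c u : {ffun 'I_n -> int} := projT1 (cid (hb u)).
have cP u : u = \sum_(i < n) b i *~ c u i by rewrite /c; case: cid => x [].
have cU u (d : {ffun 'I_n -> int}) : u = \sum_(i < n) b i *~ d i -> c u = d.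
  rewrite /c; case: cid => x [_ h] /=; exact: h.
pose io u : 'rV[F]_n := \row_i (c u i)%:~R.
have io_morph : GRing.zmod_morphism io.
  move=> u v; apply/rowP => i; rewrite !mxE.
  rewrite (cU (u - v) [ffun i => c u i - c v i]) ?ffunE ?rmorphB //.
  rewrite {1}(cP u) {1}(cP v) -sumrB; apply: eq_bigr => j _.
  by rewrite ffunE mulrzBr.
pose iota : {additive M -> 'rV[F]_n} :=
  HB.pack io (GRing.isZmodMorphism.Build _ _ io io_morph).
have iob i : iota (b i) = delta_mx 0 i.
  apply/rowP => j; rewrite !mxE (cU (b i) [ffun j => (j == i)%:R]).
    by rewrite ffunE /=; case: eqP.
  rewrite (bigD1 i) //= ffunE eqxx big1 ?addr0 // => l /negbTE li.
  by rewrite ffunE li.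
exists iota; split=> // W f; split.
  pose g (v : 'rV[F]_n) : W := \sum_(i < n) v 0 i *: f (b i).
  have gL : linear g.
    move=> a x y; rewrite /g scaler_sumr -big_split /=.
    by apply: eq_bigr => i _; rewrite !mxE scalerDl scalerA.
  pose gl : {linear 'rV[F]_n -> W} :=
    HB.pack g (GRing.isLinear.Build _ _ _ _ g gL).
  exists gl => u; rewrite {2}(cP u) raddf_sum; apply: eq_bigr => i _.
  by rewrite mxE raddfMz scaler_int.
move=> g1 g2 h1 h2 v; rewrite (row_sum_delta v) !linear_sum.
by apply: eq_bigr => i _; rewrite !linearZ -iob h1 h2.
Qed.

Definition Aff (M : zmodType) (S : {fset M}) : set M :=
  [set v | exists a : M -> int,
     \sum_(u <- S) a u = 1 /\ v = \sum_(u <- S) u *~ a u].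

(* Distinct points of S may have the same image under iota when F has positive
   characteristic, hence coefficients indexed by S and not by its image. *)
Definition AffK (F : fieldType) (M : zmodType) (V : lmodType F)
    (iota : {additive M -> V}) (S : {fset M}) : set V :=
  [set v | exists a : M -> F,
     \sum_(u <- S) a u = 1 /\ v = \sum_(u <- S) a u *: iota u].

(* The dimension of an affine subspace v + U is that of its direction U; the
   value is the junk 0 on sets that are not affine subspaces, such as the empty
   set. *)
Definition affdim (F : fieldType) (V : vectType F) (E : set V) : nat :=
  xget 0%N [set d | exists (v : V) (U : {vspace V}),
    \dim U = d /\ E = [set v + w | w in [set w | w \in U]]].

Definition diffset (M : zmodType) (S : set M) : set M :=
  [set u - v | u in S & v in S].

Definition gen_subgroup (M : zmodType) (S : set M) : set M :=
  smallest [set H : set M | GRing.zmod_closed [in H]] S.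

Definition lin_span (F : fieldType) (V : lmodType F) (S : set V) : set V :=
  smallest [set H : set V | GRing.submod_closed [in H]] S.

Definition spanning_sums (F : fieldType) (M : zmodType) (V : lmodType F)
    (iota : {additive M -> V}) (n : nat) (A : {fset M}) : set M :=
  [set v | exists t : 'I_n.+1 -> M,
     [/\ forall i, t i \in A,
         AffK iota [fset t i | i : 'I_n.+1]%fset = setT &
         v = \sum_i t i]].

(* <S>_F \cap M, that is, the u in M whose image in M (x) F lies in the
   F-subspace spanned by the image of <S>. *)
Definition span_cap (F : fieldType) (M : zmodType) (V : lmodType F)
    (iota : {additive M -> V}) (S : set M) : {pred M} :=
  fun u => `[< lin_span (iota @` gen_subgroup S) (iota u) >].

Lemma lin_span_submod (F : fieldType) (V : lmodType F) (S : set V) :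
  GRing.submod_closed [in lin_span S].
Proof.
split=> [|a x y]; rewrite !inE.
  by move=> H /= [[H0 _] _]; move: H0; rewrite !inE.
move=> Sx Sy H /= HH; case: (HH) => -[_ HD] _.
have := HD a x y; rewrite !inE; apply; [exact: Sx | exact: Sy].
Qed.

Lemma span_cap_zmod (F : fieldType) (M : zmodType) (V : lmodType F)
    (iota : {additive M -> V}) (S : set M) :
  GRing.zmod_closed (span_cap iota S).
Proof.
have [H0 HD] := lin_span_submod (iota @` gen_subgroup S).
split=> [|u v]; rewrite /span_cap !unfold_in.
  by apply/asboolP; rewrite raddf0; move: H0; rewrite !inE.
move=> /asboolP Su /asboolP Sv; apply/asboolP; rewrite raddfB /=.
have := HD (-1) (iota v) (iota u); rewrite !inE scaleN1r addrC; exact.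
Qed.

HB.instance Definition _ (F : fieldType) (M : zmodType) (V : lmodType F)
    (iota : {additive M -> V}) (S : set M) :=
  GRing.isZmodClosed.Build M (span_cap iota S) (span_cap_zmod iota S).

(* The quotient group M / (<S>_F \cap M) and the natural projection onto it. *)
Definition quot_span_cap (F : fieldType) (M : zmodType) (V : lmodType F)
    (iota : {additive M -> V}) (S : set M) : zmodType :=
  @Quotient.quot M (span_cap iota S).

Definition proj_span_cap (F : fieldType) (M : zmodType) (V : lmodType F)
    (iota : {additive M -> V}) (S : set M) :
    {additive M -> quot_span_cap iota S} :=
  \pi_(@Quotient.quot M (span_cap iota S))%qT.

(* Main.v *)
Require Import Defs.
From HB Require Import structures.
From mathcomp Require Import all_boot all_order all_algebra finmap.
From mathcomp Require Import boolp classical_sets reals.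

Set Implicit Arguments.
Unset Strict Implicit.
Unset Printing Implicit Defensive.

Import GRing.Theory.

Local Open Scope ring_scope.
Local Open Scope classical_set_scope.

(** The statement is about the matroid of affine independence over [k] on [A].
Lifting [u] in [M] to [(1, u)] in [k * Mk] turns affine combinations into linear
ones: affine independence becomes linear independence, and an affine subspace of
dimension [d] becomes a linear one of dimension [d + 1] ([AffK_lift],
[affdim_AffK], [AffK_full]). Since [Aff A = M], the lifts of [A] span [k * Mk],
which has dimension [n + 1], and [B] consists of the sums of those subsets of
[A] whose lifts form a basis ([spanning_sumsP]).

As [Mt] is torsion-free, killing [<B - B>] is the same as killing its
saturation, so [pit] factors through [pi] iff it kills [<B - B>] ([factorsP]),
which means that the sum of [pit] over a basis contained in [A] is the same for
all bases. The matroid statement [basis_sum_constP] says that this happens iff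
the ranks of the classes [A_w] of [A] under [pit] add up to the rank of [A]:
- a basis meets [A_w] in at most [rank A_w] points; if the ranks add up, all
  these bounds are attained, and the sum of [pit] over a basis is
  [\sum_w rank A_w * w];
- conversely, exchanging a point of a basis for [x] in [A] does not change the
  sum of [pit], so [x] is exchangeable only with points of its own class, that
  is, [x] is a combination of the basis points in its class. Hence a basis meets
  each [A_w] in a basis of the span of [A_w], and the ranks add up.

Each of the [N + 1] classes has rank one more than its affine dimension, so the
ranks add up to [n + 1] iff the affine dimensions add up to [n - N]. *)

(** * Spans and sums over lists *)

Lemma mem_span_map (F : fieldType) (W : vectType F) (M : eqType) (f : M -> W)
    (s : seq M) (v : W) : uniq s ->
  v \in <<map f s>>%VS <-> exists a : M -> F, v = \sum_(u <- s) a u *: f u.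
Proof.
move=> us; split=> [|[a ->]]; last first.
  rewrite big_seq; apply: memv_suml => u us'; apply/memvZ/memv_span.
  exact: map_f.
elim: s us v => [_ v|x s IH /= /andP[xs us] v].
  by rewrite span_nil memv0 => /eqP ->; exists (fun=> 0); rewrite big_nil.
rewrite span_cons => /memv_addP[_ /vlineP[c ->]] [w /(IH us)[a ->] ->].
exists (fun u => if u == x then c else a u); rewrite big_cons eqxx.
congr (_ + _); apply: eq_big_seq => u us'.
by case: eqP us' xs => // -> ->.
Qed.

Lemma sum_by_classes (V : nmodType) (M T : eqType) (p : M -> T) (g : M -> V)
    (ws : seq T) (b : seq M) : uniq ws -> {subset map p b <= ws} ->
  \sum_(u <- b) g u = \sum_(w <- ws) \sum_(u <- b | p u == w) g u.
Proof.
move=> uws bws.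
under [RHS]eq_bigr => w _ do rewrite big_mkcond.
rewrite exchange_big /=; apply: eq_big_seq => u ub.
rewrite (bigD1_seq (p u)) ?bws ?map_f //= eqxx big1 ?addr0 // => w.
by rewrite eq_sym => /negbTE ->.
Qed.

(** * Bases with a constant sum *)

Section Matroid.

Variables (F : fieldType) (W : vectType F) (M : eqType) (f : M -> W).

(** A basis is recorded by the list [b] of its indices, as the sums of interest
are taken over the indices while independence is that of their images. *)
Lemma exists_basis_subseq (s : seq M) :
  exists2 b : seq M, {subset b <= s} & basis_of <<map f s>> (map f b).
Proof.
elim: s => [|x s [b bs bB]]; first by exists [::]; rewrite // span_nil nil_basis.
have sb := span_basis bB; have fb := basis_free bB.
have [xb|xb] := boolP (f x \in <<map f s>>%VS).
  exists b => [u /bs us|]; first by rewrite inE us orbT.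
  by rewrite /= span_cons (addv_idPr _) // -memvE.
exists (x :: b) => [u|].
  by rewrite !inE => /orP[->//|/bs ->]; rewrite orbT.
by rewrite /basis_of /= !span_cons sb eqxx free_cons sb xb.
Qed.

Lemma free_count_le (T : eqType) (p : M -> T) (s b : seq M) (w : T) :
  {subset b <= s} -> free (map f b) ->
  (count (fun u => p u == w) b <= \dim <<map f [seq u <- s | p u == w]>>)%N.
Proof.
move=> bs fb; pose bw := [seq u <- b | p u == w].
have fw : free (map f bw).
  have pb : perm_eq (map f b) (map f bw ++ map f [seq u <- b | p u != w]).
    by rewrite -map_cat perm_sym; apply/perm_map/permEl/perm_filterC.
  by move: fb; rewrite (perm_free pb); apply: catl_free.
rewrite -size_filter -/bw -(size_map f) -(eqnP fw); apply/dimvS/sub_span.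
move=> v /mapP[u]; rewrite mem_filter => /andP[pu /bs us] ->.
by apply: map_f; rewrite mem_filter pu.
Qed.

(** The predicate [q] is only known to hold at the points of [b] that can be
exchanged for [x]. These are exactly the points with a nonzero coefficient in
the expansion of [f x] in the basis: if [c (f u) != 0], then [f x] in the span
of the other basis vectors would put [f u] there too. *)
Lemma basis_exchange (s b : seq M) (x : M) (q : pred M) :
    {subset b <= s} -> x \in s -> basis_of <<map f s>> (map f b) ->
    (forall u, u \in b -> basis_of <<map f s>> (map f (x :: rem u b)) -> q u) ->
  f x \in <<map f [seq u <- b | q u]>>%VS.
Proof.
move=> bs xs bB hq; have sb := span_basis bB; have fb := basis_free bB.
have xb : f x \in <<map f b>>%VS by rewrite sb memv_span // map_f.
have [c xE _] := free_span fb xb.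
have qP u : u \in b -> c (f u) != 0 -> q u.
  move=> ub cu0; apply: hq => //.
  have bu := perm_to_rem ub.
  have : free (map f (u :: rem u b)) by rewrite -(perm_free (perm_map f bu)).
  rewrite /= free_cons => /andP[uNr fr].
  have xNr : f x \notin <<map f (rem u b)>>%VS.
    apply: contra uNr => xr.
    move: xE; rewrite big_map (perm_big _ bu) big_cons /= => xE.
    have : c (f u) *: f u \in <<map f (rem u b)>>%VS; last first.
      by rewrite rpredZeq (negbTE cu0).
    have -> : c (f u) *: f u = f x - \sum_(v <- rem u b) c (f v) *: f v.
      by rewrite xE addrK.
    apply: rpredB xr _; rewrite big_seq; apply: memv_suml => v vr.
    exact/memvZ/memv_span/map_f.
  rewrite basisEfree /= free_cons xNr fr /=; apply/andP; split.
    apply/span_subvP => v; rewrite inE => /orP[/eqP ->|/mapP[z zr ->]].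
      by rewrite -sb.
    by apply: memv_span; apply: map_f; apply: bs; apply: mem_rem zr.
  by rewrite -sb (eqnP fb) /= !size_map (perm_size bu).
rewrite xE big_map big_seq; apply: memv_suml => u ub.
have [->|cu0] := eqVneq (c (f u)) 0; first by rewrite scale0r mem0v.
by apply/memvZ/memv_span/map_f; rewrite mem_filter qP.
Qed.

(** The value [p] is constant in sum over the bases exactly when the matroid on
[s] is the direct sum of its restrictions to the fibres of [p]. *)
Theorem basis_sum_constP (T : zmodType) (p : M -> T) (s : seq M) (ws : seq T) :
    uniq ws -> {subset map p s <= ws} ->
  (forall b b' : seq M, {subset b <= s} -> {subset b' <= s} ->
     basis_of <<map f s>> (map f b) -> basis_of <<map f s>> (map f b') ->
     \sum_(u <- b) p u = \sum_(u <- b') p u) <->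
  (\sum_(w <- ws) \dim <<map f [seq u <- s | p u == w]>> = \dim <<map f s>>)%N.
Proof.
move=> uws sws; set U := <<map f s>>%VS.
have bws b : {subset b <= s} -> {subset map p b <= ws}.
  by move=> bs _ /mapP[u /bs us ->]; apply/sws/map_f.
have sizeE b : {subset b <= s} -> basis_of U (map f b) ->
    \dim U = (\sum_(w <- ws) count (fun u => p u == w) b)%N.
  move=> bs bB; rewrite -(span_basis bB) (eqnP (basis_free bB)) size_map.
  rewrite -sum1_size (sum_by_classes _ uws (bws b bs)).
  by apply: eq_bigr => w _; rewrite sum1_count.
split=> [hconst|hdim].
  have [b bs bB] := exists_basis_subseq s.
  rewrite (sizeE b) //; apply: eq_bigr => w _; apply/eqP; rewrite eqn_leq.
  rewrite free_count_le ?(basis_free bB) // andbT -size_filter -(size_map f).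
  apply: leq_trans (dim_span _); apply/dimvS/span_subvP => y /mapP[x].
  rewrite mem_filter => /andP[/eqP <- xs] ->.
  apply: (basis_exchange bs xs bB) => u ub xB.
  have xrs : {subset x :: rem u b <= s}.
    by move=> v; rewrite inE => /orP[/eqP ->//|/mem_rem/bs].
  have := hconst _ _ xrs bs xB bB.
  by rewrite (perm_big _ (perm_to_rem ub)) !big_cons => /addIr ->.
(* The right-hand side does not depend on the basis. *)
suff sumE b : {subset b <= s} -> basis_of U (map f b) ->
    \sum_(u <- b) p u =
    \sum_(w <- ws) w *+ \dim <<map f [seq u <- s | p u == w]>>.
  by move=> b b' bs b's bB b'B; rewrite !sumE.
move=> bs bB; rewrite (sum_by_classes _ uws (bws b bs)).
apply: eq_big_seq => w wws.
have -> : \sum_(u <- b | p u == w) p u = w *+ count (fun u => p u == w) b.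
  rewrite -sum1_count -sumrMnr; apply: eq_bigr => u /eqP ->.
  by rewrite mulr1n.
congr (_ *+ _); apply/eqP; move: wws; rewrite eqn_leq.
rewrite free_count_le ?(basis_free bB) //= => wws.
(* One class with fewer basis points than its rank would leave the basis too
   short, since no other class can make up for it. *)
rewrite leqNgt; apply/negP => ltw.
suff : (\dim U < \dim U)%N by rewrite ltnn.
rewrite [X in (X < _)%N](sizeE b) // -hdim !(bigD1_seq w) //= -addSn leq_add //.
by apply: leq_sum => z _; apply: free_count_le (basis_free bB).
Qed.

End Matroid.

(** * Extension of scalars *)

Section ScalarExtension.

Variables (F : fieldType) (M : zmodType).

(** Reduces every statement about an abstract extension of scalars to the
coordinate model given by a basis of [M]. *)
Lemma scalar_extension_iso (V V' : lmodType F) (i : {additive M -> V})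
    (i' : {additive M -> V'}) :
  is_scalar_extension i -> is_scalar_extension i' ->
  exists (g : {linear V -> V'}) (h : {linear V' -> V}),
    [/\ forall u, g (i u) = i' u, forall u, h (i' u) = i u,
        cancel g h & cancel h g].
Proof.
move=> hi hi'.
have [[g gE] _] := hi V' i'; have [[h hE] _] := hi' V i.
exists g, h; split=> // x.
  have [_ /(_ (h \o g)%FUN idfun)] := hi V i.
  by apply=> // u /=; rewrite gE hE.
have [_ /(_ (g \o h)%FUN idfun)] := hi' V' i'.
by apply=> // u /=; rewrite hE gE.
Qed.

Lemma scalar_extension_span (n : nat) (b : 'I_n -> M) (V : lmodType F)
    (i : {additive M -> V}) (x : V) : is_basis b -> is_scalar_extension i ->
  exists c : 'I_n -> F, x = \sum_(j < n) c j *: i (b j).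
Proof.
move=> hb hi; have [i0 [i0b hi0]] := is_scalar_extension_coord F hb.
have [g [h [_ hE gK _]]] := scalar_extension_iso hi hi0.
exists (fun j => g x 0 j); rewrite -[LHS](gK x) [in LHS](row_sum_delta (g x)) linear_sum.
by apply: eq_bigr => j _; rewrite linearZ /= -i0b hE.
Qed.

Lemma scalar_extension_dim (n : nat) (V : vectType F) (i : {additive M -> V}) :
  free_abelian M n -> is_scalar_extension i -> dim V = n.
Proof.
move=> [b hb] hi; have [i0 [_ hi0]] := is_scalar_extension_coord F hb.
have [g [h [_ _ gK hK]]] := scalar_extension_iso hi hi0.
have kg : lker (linfun g) == 0%VS.
  by apply/lker0P => x y; rewrite !lfunE => /(can_inj gK).
have lg : limg (linfun g) = fullv.
  apply/vspaceP => y; rewrite memvf; apply/memv_imgP.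
  by exists (h y); rewrite ?memvf // lfunE /= hK.
rewrite -dimvf -(limg_dim_eq (f := linfun g)) ?(eqP kg) ?capv0 //.
by rewrite lg dimvf dim_matrix mul1r.
Qed.

Lemma scalar_extension_inj (n : nat) (V : lmodType F) (i : {additive M -> V}) :
    [pchar F] =i pred0 -> free_abelian M n -> is_scalar_extension i ->
  injective i.
Proof.
move=> F0 [b hb] hi; have [i0 [i0b hi0]] := is_scalar_extension_coord F hb.
have [g [_ [gE _ _ _]]] := scalar_extension_iso hi hi0.
suff ker0 u : i u = 0 -> u = 0.
  by move=> u v uv; apply: subr0_eq; apply: ker0; rewrite raddfB uv subrr.
move=> iu0; have [c [uE _]] := hb u.
have /rowP i0u : i0 u = 0 by rewrite -gE iu0 raddf0.
rewrite uE big1 // => j _; suff -> : c j = 0 by rewrite mulr0z.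
have := i0u j; rewrite uE raddf_sum summxE (bigD1 j) //= big1 => [|l /negbTE lj].
  rewrite raddfMz i0b addr0 -scaler_int !mxE !eqxx mulr1.
  have /pcharf0P hm := F0; case: (c j) => m.
    by rewrite -pmulrn => /eqP; rewrite hm => /eqP ->.
  by rewrite NegzE mulrNz => /eqP; rewrite oppr_eq0 -pmulrn hm.
by rewrite raddfMz i0b -scaler_int !mxE eq_sym lj mulr0.
Qed.

End ScalarExtension.

(** * Affine spans as slices of linear spans *)

Section AffineSpan.

Variables (F : fieldType) (V : vectType F) (M : zmodType).
Variable iota : {additive M -> V}.

(** Homogenization: the linear span of lifted points meets the hyperplane of
first coordinate 1 in the affine span of the points. *)
Definition affine_lift (u : M) : (F^o * V)%type := (1, iota u).

Lemma affine_lift_sum (s : seq M) (a : M -> F) :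
  \sum_(u <- s) a u *: affine_lift u =
  (\sum_(u <- s) a u, \sum_(u <- s) a u *: iota u).
Proof.
elim: s => [|u s IH]; first by rewrite !big_nil.
by rewrite !big_cons IH /affine_lift; congr (_ , _); rewrite /= -[_ *: 1]/(_ * _) mulr1.
Qed.

Lemma AffK_lift (S : {fset M}) :
  AffK iota S =
  [set x | ((1, x) : (F^o * V)%type) \in <<map affine_lift S>>%VS].
Proof.
apply/seteqP; split=> x /=.
  move=> [a [a1 ->]]; apply/(mem_span_map _ _ (fset_uniq S)); exists a.
  by rewrite affine_lift_sum a1.
move=> /(mem_span_map _ _ (fset_uniq S))[a]; rewrite affine_lift_sum.
by case=> a1 ->; exists a; rewrite a1.
Qed.

(** The direction of an affine subspace is determined by its set of points, so
the choice in [affdim] does not matter. *)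
Lemma affdim_coset (v : V) (U : {vspace V}) :
  affdim [set v + w | w in [set w | w \in U]] = \dim U.
Proof.
rewrite /affdim; case: xgetP => [d _ [v' [U' [<- E]]]|/(_ (\dim U)) []]; last first.
  by exists v, U.
have [w0 w0U v'E] : [set v + w | w in [set w | w \in U]] v'.
  by rewrite E /=; exists 0; rewrite ?addr0 //= mem0v.
congr (\dim _); apply/vspaceP => w; apply/idP/idP => wU.
  have [z zU zE] : [set v + w | w in [set w | w \in U]] (v' + w).
    by rewrite E; exists w.
  suff -> : w = z - w0 by apply: rpredB.
  by apply: (addrI v'); rewrite -zE -v'E addrA addrAC addrK.
have [z zU zE] : [set v' + w | w in [set w | w \in U']] (v' + w).
  by rewrite -E -v'E; exists (w0 + w); rewrite ?addrA //=; apply: rpredD.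
by move/addrI: zE => <-.
Qed.

(** The direction of the affine span is the kernel of the first coordinate on the
linear span of the lifts. That coordinate takes the value 1 as soon as [S] has a
point, so its kernel has codimension one; the empty set has to be excluded. *)
Lemma affdim_AffK (S : {fset M}) : S != fset0 ->
  (affdim (AffK iota S)).+1 = \dim <<map affine_lift S>>.
Proof.
move=> /fset0Pn[s0 s0S]; rewrite AffK_lift; set U := <<_>>%VS.
have s0U : affine_lift s0 \in U by apply/memv_span/map_f.
pose f1 : 'Hom((F^o * V)%type, F^o) := linfun fst.
pose f2 : 'Hom((F^o * V)%type, V) := linfun snd.
pose K := (U :&: lker f1)%VS.
have KE x y : ((x, y) \in K) = (x == 0) && ((x, y) \in U).
  by rewrite memv_cap memv_ker lfunE /= andbC.
have -> : [set x | ((1, x) : (F^o * V)%type) \in U] =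
    [set iota s0 + w | w in [set w | w \in (f2 @: K)%VS]].
  apply/seteqP; split=> [x xU|_ [_ /memv_imgP[[y z] yzK ->] <-]] /=.
    exists (x - iota s0); last by rewrite addrC subrK.
    apply/memv_imgP; exists (0, x - iota s0); last by rewrite lfunE.
    rewrite KE eqxx; have := rpredB xU s0U.
    by rewrite /affine_lift -[(1, x) - _]/(1 - 1, x - iota s0) subrr.
  move: yzK; rewrite KE lfunE /= => /andP[/eqP -> zU].
  have := rpredD s0U zU.
  by rewrite /affine_lift -[(1, _) + _]/(1 + 0, iota s0 + z) addr0.
rewrite affdim_coset -(limg_ker_dim f1 U) -/K -addn1; congr (_ + _)%N.
  apply: limg_dim_eq; apply/eqP; rewrite -subv0; apply/subvP => -[y z].
  rewrite memv_cap KE memv_ker lfunE /= => /andP[/andP[/eqP -> _] /eqP ->].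
  exact: mem0v.
have -> : (f1 @: U = fullv)%VS.
  apply/vspaceP => y; rewrite memvf; apply/memv_imgP.
  exists (y *: affine_lift s0); first exact: memvZ.
  by rewrite lfunE /= -[y *: 1]/(y * 1) mulr1.
by rewrite dimvf /dim.
Qed.

Lemma AffK_full (S : {fset M}) :
  AffK iota S = setT <-> <<map affine_lift S>>%VS = fullv.
Proof.
rewrite AffK_lift; split=> [E|->]; last first.
  by apply/seteqP; split=> x //= _; apply: memvf.
have inU x : ((1, x) : (F^o * V)%type) \in <<map affine_lift S>>%VS.
  by have : [set: V] x by []; rewrite -E.
apply/vspaceP => -[y x]; rewrite memvf.
have -> : (y, x) = y *: ((1, 0) : (F^o * V)%type) + ((1, x) - (1, 0)).
  congr (_, _); rewrite /= ?scaler0 ?add0r ?subr0 //.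
  by rewrite -[y *: 1]/(y * 1) mulr1 subrr addr0.
by apply: rpredD; [apply: memvZ | apply: rpredB].
Qed.

(** Integral affine combinations give [iota u] for all [u]; every vector is then
reached, because [\sum_j c j *: iota (b j)] is the affine combination
[iota 0 + \sum_j c j *: (iota (b j) - iota 0)] of such points. *)
Lemma AffK_full_of_Aff (n : nat) (A : {fset M}) :
  free_abelian M n -> is_scalar_extension iota -> Aff A = setT ->
  AffK iota A = setT.
Proof.
move=> [b hb] hi hA.
have inA u : AffK iota A (iota u).
  have [a [a1 ->]] : Aff A u by rewrite hA.
  exists (fun u => (a u)%:~R); rewrite -raddf_sum a1; split=> //.
  by rewrite raddf_sum; apply: eq_bigr => v _; rewrite raddfMz scaler_int.
apply/seteqP; split=> x // _; rewrite AffK_lift /=; set U := <<_>>%VS.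
have {}inA u : ((1, iota u) : (F^o * V)%type) \in U.
  by have := inA u; rewrite AffK_lift.
have [c ->] := scalar_extension_span x hb hi.
have -> : (1, \sum_j c j *: iota (b j)) =
    ((1, iota 0) : (F^o * V)%type)
    + \sum_j c j *: ((1, iota (b j)) - ((1, iota 0) : (F^o * V)%type)).
  rewrite -[RHS]/((_, _)) raddf0 (raddf_sum fst) (raddf_sum snd) /= add0r.
  congr (_, _); first by rewrite big1 ?addr0 // => j _; rewrite /= subrr scaler0.
  by apply: eq_bigr => j _; rewrite /= subr0.
by apply: rpredD => //; apply: memv_suml => j _; apply/memvZ/rpredB.
Qed.

End AffineSpan.

(** * The set B as the set of sums over bases *)

Section SpanningSums.

Variables (F : fieldType) (V : vectType F) (M : zmodType) (n : nat).
Variables (iota : {additive M -> V}) (A : {fset M}).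
Hypotheses (hM : free_abelian M n) (hi : is_scalar_extension iota).
Hypothesis hA : <<map (affine_lift iota) A>>%VS = fullv.

Lemma dim_affine_lift : \dim {:(F^o * V)%type} = n.+1.
Proof.
by rewrite dimvf -(scalar_extension_dim hM hi).
Qed.

(** A tuple of [n + 1] points with full affine span is the same as a list whose
lifts form a basis, since the lifted space has dimension [n + 1]. *)
Lemma spanning_sumsP (v : M) :
  spanning_sums iota n A v <->
  exists b : seq M, [/\ {subset b <= A},
    basis_of <<map (affine_lift iota) A>> (map (affine_lift iota) b) &
    v = \sum_(u <- b) u].
Proof.
rewrite hA; split=> [[t [tA /AffK_full tV ->]]|[b [bA bB ->]]].
  exists (codom t); split=> [_ /codomP[i ->] //||]; last by rewrite big_image.
  rewrite basisEdim -tV size_map size_codom card_ord tV dim_affine_lift leqnn andbT.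
  rewrite -tV; apply: sub_span => _ /mapP[u /imfsetP[i /= _ ->] ->].
  exact/map_f/codom_f.
have bn : size b = n.+1.
  by rewrite -dim_affine_lift -(span_basis bB) (eqnP (basis_free bB)) size_map.
exists (fun i => b`_i); split=> [i||].
- by apply/bA/mem_nth; rewrite bn.
- apply/AffK_full; rewrite -(span_basis bB); apply/eq_span/eq_mem_map => u.
  apply/imfsetP/idP => [[i _ ->]|ub]; first by apply: mem_nth; rewrite bn.
  have ui : (index u b < n.+1)%N by rewrite -bn index_mem.
  by exists (Ordinal ui) => //=; rewrite nth_index.
- by rewrite (big_nth 0) bn big_mkord.
Qed.

End SpanningSums.

(** * Factoring through the saturated quotient *)

Section Factorization.

Variables (M M' : zmodType) (p : {additive M -> M'}).

Lemma gen_subgroup_sub_ker (S : set M) :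
  gen_subgroup S `<=` [set u | p u = 0] <-> S `<=` [set u | p u = 0].
Proof.
split=> [h u Su|h]; first by apply: h => H [_]; apply.
apply: smallest_sub => //; split=> [|u v]; rewrite !inE /= ?raddf0 //.
by rewrite raddfB => -> ->; rewrite subr0.
Qed.

Lemma diffset_sub_ker (S : set M) :
  diffset S `<=` [set u | p u = 0] <->
  (forall u v, S u -> S v -> p u = p v).
Proof.
split=> [h u v Su Sv|h _ [u Su [v Sv <-]]] /=.
  by apply: subr0_eq; rewrite -raddfB; apply: h; exists u => //; exists v.
by rewrite raddfB (h _ _ Su Sv) subrr.
Qed.

Variables (R : fieldType) (V : lmodType R) (iota : {additive M -> V}).
Variables (S : set M).

(** No denominators need to be cleared: [p] followed by the embedding of [M'] in
its scalar extension extends to a linear map on [V]. It vanishes on [S], hence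
on its linear span, and the embedding is injective in characteristic zero. *)
Lemma span_cap_sub_ker (m : nat) : [pchar R] =i pred0 ->
    free_abelian M' m -> is_scalar_extension iota ->
    gen_subgroup S `<=` [set u | p u = 0] ->
  forall u, u \in span_cap iota S -> p u = 0.
Proof.
move=> R0 hM' hi hS u; rewrite unfold_in => /asboolP hu.
have [b hb] := hM'; have [i0 [_ hi0]] := is_scalar_extension_coord R hb.
apply: (scalar_extension_inj R0 hM' hi0); rewrite raddf0.
have [[g gE] _] := hi _ (i0 \o p)%FUN.
rewrite -[i0 (p u)]gE.
apply: (hu [set x | g x = 0]); split=> [|_ [w /hS /= pw <-]] /=.
  split=> [|a x y]; rewrite !inE /= ?linear0 // linearP => -> ->.
  by rewrite scaler0 addr0.
by rewrite gE /= pw raddf0.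
Qed.

Lemma factors_of_span_cap : (forall u, u \in span_cap iota S -> p u = 0) ->
  exists phi : {additive quot_span_cap iota S -> M'},
    forall u, p u = phi (proj_span_cap iota S u).
Proof.
move=> hp.
have piE u : p (repr (proj_span_cap iota S u)) = p u.
  apply: subr0_eq; rewrite -raddfB; apply: hp.
  by rewrite (Quotient.idealrBE (span_cap iota S)) reprK.
have phiB : GRing.zmod_morphism (fun x : quot_span_cap iota S => p (repr x)).
  move=> x y /=; have -> : x - y = proj_span_cap iota S (repr x - repr y).
    by rewrite raddfB /= !reprK.
  by rewrite piE raddfB.
pose phi : {additive quot_span_cap iota S -> M'} :=
  HB.pack (fun x : quot_span_cap iota S => p (repr x))
    (GRing.isZmodMorphism.Build _ _ _ phiB).
by exists phi => u; rewrite -[RHS]/(p (repr (proj_span_cap iota S u))) piE.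
Qed.

Lemma factorsP (m : nat) : [pchar R] =i pred0 -> free_abelian M' m ->
    is_scalar_extension iota ->
  (exists phi : {additive quot_span_cap iota S -> M'},
    forall u, p u = phi (proj_span_cap iota S u)) <->
  gen_subgroup S `<=` [set u | p u = 0].
Proof.
move=> R0 hM' hi; split=> [[phi pE] u Su /=|hS]; last first.
  exact/factors_of_span_cap/(span_cap_sub_ker R0 hM').
rewrite pE; suff -> : proj_span_cap iota S u = 0 by rewrite raddf0.
have uS : u \in span_cap iota S.
  by rewrite unfold_in; apply/asboolP => H [_]; apply; exists u.
apply/eqP; rewrite -(raddf0 (proj_span_cap iota S)).
by rewrite -(Quotient.idealrBE (span_cap iota S)) subr0.
Qed.

End Factorization.

(** * The factorization criterion *)

Theorem proposition4p1 (k : closedFieldType) (R : realType)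
    (n : nat) (M : zmodType) (hM : free_abelian M n)
    (Mk : vectType k) (iota : {additive M -> Mk})
    (hk : is_scalar_extension iota)
    (MR : lmodType R) (iotaR : {additive M -> MR})
    (hR : is_scalar_extension iotaR)
    (A : {fset M}) (hA : Aff A = setT)
    (Mt : zmodType) (hMt : exists m, free_abelian Mt m)
    (pit : {additive M -> Mt}) (hpit : range pit = setT) :
  let B := spanning_sums iota n A in
  let pi := proj_span_cap iotaR (diffset B) in
  let factors := exists phi : {additive quot_span_cap iotaR (diffset B) -> Mt},
    forall u, pit u = phi (pi u) in
  let piA := [fset pit u | u in A]%fset in
  let N : int := (#|` piA|)%:Z - 1 in
  (factors <-> gen_subgroup (diffset B) `<=` [set u | pit u = 0]) /\
  (factors <->
    (\sum_(w <- piA) affdim (AffK iota [fset u in A | pit u == w]%fset))%:Z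
      = n%:Z - N).
Proof.
move=> B pi factors piA N.
have [m hm] := hMt.
have facP : factors <-> gen_subgroup (diffset B) `<=` [set u | pit u = 0].
  exact: factorsP (Num.Theory.pchar_num R) hm hR.
split=> //; apply: (iff_trans facP).
apply: (iff_trans (gen_subgroup_sub_ker _ _)).
apply: (iff_trans (diffset_sub_ker _ _)).
have AV : <<map (affine_lift iota) A>>%VS = fullv.
  by apply/AffK_full; apply: AffK_full_of_Aff hM hk hA.
have BP := spanning_sumsP hM hk AV.
have piAP : {subset map pit A <= piA}.
  by move=> _ /mapP[u uA ->]; apply: in_imfset.
have matroid := basis_sum_constP (affine_lift iota) (fset_uniq piA) piAP.
have dimA : \dim <<map (affine_lift iota) A>> = n.+1.
  by rewrite AV (dim_affine_lift hM hk).
have dimE w : w \in piA ->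
    \dim <<map (affine_lift iota) [seq u <- A | pit u == w]>> =
    (affdim (AffK iota [fset u in A | pit u == w]%fset) + 1)%N.
  move=> /imfsetP[u /= uA wE]; rewrite addn1 affdim_AffK.
    congr (\dim _); apply/eq_span/eq_mem_map => v.
    by rewrite mem_filter !inE andbC.
  by apply/fset0Pn; exists u; rewrite !inE wE uA eqxx.
rewrite dimA (eq_big_seq _ dimE) big_split /= sum1_size in matroid.
apply: (iff_trans _ (iff_trans matroid _)).
  split=> [h b b' bA b'A bB b'B|h u v /BP[b [bA bB ->]] /BP[b' [b'A b'B ->]]].
    rewrite -!raddf_sum; apply: h; apply/BP.
      by exists b.
    by exists b'.
  by rewrite !raddf_sum; apply: h.
rewrite /N; set a := (\sum_(_ <- _) _)%N; set c := #|` piA|.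
split=> [h|h].
  by apply/eqP; rewrite opprB addrA eq_sym subr_eq -!PoszD addn1 -h.
have : (a + c)%:Z = n.+1%:Z :> int.
  by rewrite -addn1 !PoszD h opprB addrA subrK.
by case.
Qed.
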